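(* Let $k$ be an integer with $1\le k\le n$, and let $V_1,\dots,V_n$ be open subsets of the unit sphere $S^{n-1}\subset\mathbb R^n$ such that each $V_i$ intersects every $k$-subsphere. Then there exists a $k$-half-sphere that intersects every $V_i$.
   Context: A $k$-subsphere is the intersection $L\cap S^{n-1}$ of a $k$-dimensional linear subspace $L\subseteq\mathbb R^n$ with the unit sphere. A $k$-half-sphere is a (closed) half of a $k$-subsphere, i.e. a set $\{x\in L\cap S^{n-1}:(u,x)\ge0\}$ for a $k$-dimensional linear subspace $L$ and a unit vector $u\in L$. *)

(* Defs.v *)
From HB Require Import structures.
From mathcomp Require Import all_boot all_order all_algebra.
From mathcomp Require Import all_classical all_reals all_analysis.

Set Implicit Arguments.
Unset Strict Implicit.
Unset Printing Implicit Defensive.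

Import Order.TTheory GRing.Theory Num.Theory.
Import numFieldNormedType.Exports.

Local Open Scope classical_set_scope.
Local Open Scope ring_scope.

Definition inner (R : realType) (n : nat) (u x : 'rV[R]_n) : R :=
  \sum_(i < n) u 0 i * x 0 i.

(* The library norm [`|x|] on ['rV[R]_n] is the max norm: it induces the usual
   topology but not the Euclidean unit sphere. *)
Definition enorm (R : realType) (n : nat) (x : 'rV[R]_n) : R :=
  Num.sqrt (inner x x).

Definition usphere (R : realType) (n : nat) : set 'rV[R]_n :=
  [set x | enorm x = 1].

Definition open_in_usphere (R : realType) (n : nat) (V : set 'rV[R]_n) : Prop :=
  exists2 U : set 'rV[R]_n, open U & V = U `&` @usphere R n.

(* Indexed by the dimension [k] of the linear subspace, so that a
   [k]-subsphere is a sphere of dimension [k - 1]. *)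
Definition subsphere (R : realType) (n k : nat) (C : set 'rV[R]_n) : Prop :=
  exists2 L : {vspace 'rV[R]_n},
    \dim L = k & C = [set x | x \in L] `&` @usphere R n.

Definition half_sphere (R : realType) (n k : nat) (H : set 'rV[R]_n) : Prop :=
  exists (L : {vspace 'rV[R]_n}) (u : 'rV[R]_n),
    [/\ \dim L = k, u \in L, enorm u = 1 &
        H = [set x | x \in L] `&` @usphere R n `&` [set x | 0 <= inner u x]].

(* Main.v *)
Require Import Defs.
From mathcomp Require Import all_boot all_order all_algebra.
From mathcomp Require Import all_classical all_reals all_analysis.
From mathcomp Require Import ring lra.

(** Let [M] be a [(k-1)]-dimensional subspace through points of the first [k-1]
    sets. The half-spheres of [M + R v] on the side of [v], for [v] orthogonal to
    [M], all meet these sets, and the [v] for which such a half-sphere meets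
    [V_i] form an open set [A_i] which together with [-A_i] covers the sphere of
    the orthogonal complement of [M]. As that sphere has dimension [n-k] and
    [n-k+1] sets remain, the Lusternik-Schnirelmann theorem gives a common [v].

    Lusternik-Schnirelmann in dimension [d]: given [d] functions [chi_i] to
    [bool] with [chi_i (-x) = ~~ chi_i x], the sphere carries arbitrarily fine
    mod 2 chains [c_0, ..., c_d] with boundary of [c_(k+1)] equal to
    [c_k + (-c_k)]: cone off [c_k + (-c_k)] in small steps. Each cup product with
    the coboundary of [chi_i] preserves the evaluation on these chains, so the
    cup product of all of them takes the value 1 on [c_d]; hence some small
    simplex is separated by every [chi_i]. Take for [chi_i x] the truth value of
    "a ball around [x] of Lebesgue radius lies in [A_i]". *)

Set Implicit Arguments.
Unset Strict Implicit.
Unset Printing Implicit Defensive.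

Import Order.TTheory GRing.Theory Num.Theory.
Import numFieldNormedType.Exports.

Local Open Scope classical_set_scope.
Local Open Scope ring_scope.

(** * Mod 2 cochains on ordered simplices *)

Section cochains.
Variable T : Type.
Implicit Types (phi psi : seq T -> bool) (s : seq T).

(** A vertex has the empty simplex as its face, as in the augmented complex; thus a pair of
    antipodal points is a cycle. *)
Fixpoint coboundary phi s : bool :=
  if s is x :: s' then phi s' (+) coboundary (fun r => phi (x :: r)) s'
  else false.

(** Dual of the prism operator: the sum of [phi] over the simplices
    [f x_0, ..., f x_i, g x_i, ..., g x_m]. *)
Fixpoint prism (f g : T -> T) phi s : bool :=
  if s is x :: s' then
    phi (f x :: map g s) (+) prism f g (fun r => phi (f x :: r)) s'
  else false.

Lemma coboundaryD phi psi s :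
  coboundary (fun r => phi r (+) psi r) s = coboundary phi s (+) coboundary psi s.
Proof.
elim: s phi psi => //= x s IH phi psi; rewrite IH.
by rewrite addbACA.
Qed.

Lemma coboundary_map (f : T -> T) phi s :
  coboundary (fun r => phi (map f r)) s = coboundary phi (map f s).
Proof. by elim: s phi => //= x s IH phi; rewrite (IH (fun r => phi (f x :: r))). Qed.

Lemma coboundaryK phi s : coboundary (coboundary phi) s = false.
Proof.
elim: s phi => //= x s IH phi.
by rewrite (coboundaryD phi) IH addbF addbb.
Qed.

Lemma prismD f g phi psi s :
  prism f g (fun r => phi r (+) psi r) s = prism f g phi s (+) prism f g psi s.
Proof.
elim: s phi psi => //= x s IH phi psi; rewrite IH.
by rewrite addbACA.
Qed.

(** Interior faces of the prism cancel in pairs mod 2 and its side faces form the prism over the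
    boundary, which leaves the two ends. *)
Lemma prism_homotopy f g phi s :
  prism f g (coboundary phi) s (+) coboundary (prism f g phi) s =
  phi (map f s) (+) phi (map g s).
Proof.
elim: s phi => [|x s IH] phi /=; first by rewrite addbb.
rewrite (prismD f g phi (coboundary (fun r => phi (f x :: r)))).
rewrite (coboundaryD (fun r => phi [:: f x, g x & map g r])
                     (prism f g (fun r => phi (f x :: r)))).
rewrite (coboundary_map g (fun r => phi [:: f x, g x & r])).
have := IH (fun r => phi (f x :: r)); rewrite /=.
set a := prism f g (coboundary _) s; set b := coboundary _ s.
set c := phi (f x :: map f s); set d := phi (f x :: map g s).
set e := phi (g x :: map g s); set h := coboundary _ (map g s).
by move: (prism f g phi s) => q; move: a b c d e h q; do 7 case.
Qed.

End cochains.

Lemma prism_support (T : eqType) (f g : T -> T) (phi : seq T -> bool) s :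
  prism f g phi s ->
  exists2 s', phi s' & forall z, z \in s' -> exists2 x, x \in s & z = f x \/ z = g x.
Proof.
elim: s phi => //= x s IH phi; rewrite -[g x :: _]/(map g (x :: s)).
case: (boolP (phi _)) => [phis _|_ /= /IH[s' phis' s's]].
  exists (f x :: map g (x :: s)) => // z; rewrite in_cons => /orP[/eqP ->|/mapP[y ys ->]].
    by exists x; [rewrite mem_head|left].
  by exists y => //; right.
exists (f x :: s') => // z; rewrite in_cons => /orP[/eqP ->|/s's[y ys zy]].
  by exists x; [rewrite mem_head|left].
by exists y => //; rewrite in_cons ys orbT.
Qed.

(** * Hemisphere chains and their boundaries *)

Section hemispheres.
Variables (T : eqType) (nu : T -> T) (N : nat) (f : nat -> nat -> T -> T).
Variables (x0 : T) (p : nat -> T).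
Hypothesis nuK : involutive nu.
Hypothesis f0 : forall k, f k 0 =1 id.
Hypothesis fN : forall k x, f k N x = p k.
Implicit Types (phi psi : seq T -> bool) (s : seq T).

(* Evaluation of a cochain mod 2 on a [k]-dimensional hemisphere: the next
   hemisphere is the cone with apex [p k], cut into the [N] layers between the
   maps [f k t], over the sphere made of this hemisphere and its antipode. *)
Fixpoint hemisphere k phi : bool :=
  if k is k'.+1 then
    \big[addb/false]_(t < N)
      (hemisphere k' (prism (f k' t) (f k' t.+1) phi) (+)
       hemisphere k' (prism (f k' t) (f k' t.+1) phi \o map nu))
  else phi [:: x0].

Lemma hemisphereD k phi psi :
  hemisphere k (fun s => phi s (+) psi s) = hemisphere k phi (+) hemisphere k psi.
Proof.
elim: k phi psi => //= k IH phi psi; rewrite -big_split /=.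
apply: eq_bigr => t _; set P := prism _ _.
have -> : P (fun s => phi s (+) psi s) = fun s => P phi s (+) P psi s.
  by apply/funext => s; exact: prismD.
by rewrite (IH (P phi \o map nu) (P psi \o map nu)) IH addbACA.
Qed.

(** Evaluation on the whole [k]-sphere, a hemisphere plus its antipode. *)
Let antisym k phi := hemisphere k phi (+) hemisphere k (phi \o map nu).

Let antisymD k phi psi :
  antisym k (fun s => phi s (+) psi s) = antisym k phi (+) antisym k psi.
Proof.
rewrite /antisym hemisphereD (hemisphereD k (phi \o map nu) (psi \o map nu)).
by rewrite addbACA.
Qed.

Let antisym_nu k phi : antisym k (phi \o map nu) = antisym k phi.
Proof.
rewrite /antisym addbC; congr (_ (+) _); congr hemisphere.
by apply/funext => s /=; rewrite mapK.
Qed.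

Let coboundary_nu phi :
  coboundary phi \o map nu = coboundary (phi \o map nu).
Proof. by apply/funext => s /=; rewrite -coboundary_map. Qed.

(** Once the sphere is a cycle, each layer of the cone contributes the difference of its two ends,
    and these differences telescope from the identity to a constant map. *)
Let cone_coboundary k phi :
    (forall psi, antisym k (coboundary psi) = false) ->
  hemisphere k.+1 (coboundary phi) = antisym k phi.
Proof.
move=> h0.
have telescope (a : nat -> bool) m :
    \big[addb/false]_(t < m) (a t (+) a t.+1) = a 0%N (+) a m.
  elim: m => [|m IHm]; first by rewrite big_ord0 addbb.
  by rewrite big_ord_recr /= IHm addbA addbK.
have step t : antisym k (prism (f k t) (f k t.+1) (coboundary phi)) =
    antisym k (phi \o map (f k t)) (+) antisym k (phi \o map (f k t.+1)).
  rewrite -antisymD -[RHS]addbF -(h0 (prism (f k t) (f k t.+1) phi)) -antisymD.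
  congr (antisym k); apply/funext => s; rewrite -prism_homotopy /=.
  by rewrite addbK.
rewrite /= -/(antisym k _); under eq_bigr => t _ do rewrite -/(antisym k _) step.
rewrite (telescope (fun t => antisym k (phi \o map (f k t)))).
have -> : phi \o map (f k 0) = phi.
  by apply/funext => s /=; rewrite (eq_map (f0 k)) map_id.
(* The constant map [f k N] forgets which hemisphere it is applied to, so the two values cancel mod
   2. *)
have -> : antisym k (phi \o map (f k N)) = false; last by rewrite addbF.
rewrite /antisym; set u := hemisphere k _; set v := hemisphere k _.
suff -> : u = v by rewrite addbb.
congr hemisphere; apply/funext => s /=; congr phi; rewrite -map_comp.
by apply: eq_map => x /=; rewrite !fN.
Qed.

(** The cycle condition for coning is inherited: a hemisphere and its antipode have the same
    boundary sphere, which cancels in their sum. *)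
Lemma hemisphere_coboundary k phi :
  hemisphere k.+1 (coboundary phi) =
  hemisphere k phi (+) hemisphere k (phi \o map nu).
Proof.
elim: k phi => [|k IH] phi; apply: cone_coboundary => psi.
  by rewrite /antisym coboundary_nu /= !addbF addbb.
rewrite /antisym coboundary_nu !IH -!/(antisym k _).
by rewrite antisym_nu addbb.
Qed.

(** A nonzero sum has a nonzero term; [Q] is any property of simplices that passes through the
    construction, later a bound on position and size. *)
Lemma hemisphere_support (Q : nat -> seq T -> Prop) k phi :
    Q 0 [:: x0] -> (forall j s, Q j s -> Q j (map nu s)) ->
    (forall j t s s', (t < N)%N -> Q j s ->
      (forall z, z \in s' ->
        exists2 x, x \in s & z = f j t x \/ z = f j t.+1 x) -> Q j.+1 s') ->
  hemisphere k phi -> exists2 s, Q k s & phi s.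
Proof.
move=> Q0 Qnu QS; elim: k phi => [|k IH] phi; first by exists [:: x0].
move=> /= phik; have /existsP[t] : [exists t : 'I_N,
    hemisphere k (prism (f k t) (f k t.+1) phi)
    (+) hemisphere k (prism (f k t) (f k t.+1) phi \o map nu)].
  by apply: contraLR phik => /existsPn none; rewrite big1// => t _; exact/negbTE.
have supp s : Q k s -> prism (f k t) (f k t.+1) phi s -> exists2 s', Q k.+1 s' & phi s'.
  by move=> Qs /prism_support[s' phis' s's]; exists s' => //; exact: QS Qs s's.
case: (boolP (hemisphere k (prism _ _ _))) => [/IH[s Qs Ps] _|_ /= /IH[s Qs Ps]].
  exact: supp Ps.
exact: supp (Qnu _ _ Qs) Ps.
Qed.

(** * Cup products for antipodal functions *)

Variables (I : eqType) (chi : I -> T -> bool).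
Hypothesis chi_nu : forall i x, chi i (nu x) = ~~ chi i x.

(* The cup product of the coboundaries of the [0]-cochains [chi i]. *)
Fixpoint cup (l : seq I) s : bool :=
  if l is i :: l' then
    if s is x :: s' then
      if s' is y :: _ then (chi i x (+) chi i y) && cup l' s' else false
    else false
  else size s == 1%N.

(** The cup product of the 0-cochain [chi i] itself with [cup l], a primitive of [cup (i :: l)]. *)
Let cup0 (i : I) l s := if s is x :: _ then chi i x && cup l s else false.

(** This is the Leibniz rule, in which the term with the coboundary of [cup l] drops out. *)
Let coboundary_cup0 i l s :
  coboundary (cup l) =1 xpred0 -> coboundary (cup0 i l) s = cup (i :: l) s.
Proof.
have cbM b phi r : coboundary (fun u => b && phi u) r = b && coboundary phi r.
  by elim: r phi => [|x r IH] phi /=; [rewrite andbF|rewrite IH andb_addr].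
case: s => [|x [|y s]] // cocycle.
have := cocycle [:: x, y & s].
rewrite /= (cbM (chi i x) (fun r => cup l (x :: y :: r))).
move: (cup l (y :: s)) (cup l (x :: s)) (coboundary _ s) => [] [] [];
by case: (chi i x); case: (chi i y).
Qed.

Lemma coboundary_cup l s : coboundary (cup l) s = false.
Proof.
elim: l s => [|i l IH] s; last first.
  rewrite -[RHS](coboundaryK (cup0 i l) s); congr coboundary.
  by apply/funext => r; rewrite coboundary_cup0.
case: s => [|x [|y s]] //=.
have -> : coboundary (fun r : seq T => (size r).+2 == 1%N) s = false.
  by elim: s => [|z s IHs] //=; exact: IHs.
by rewrite addbF addbb.
Qed.

Let cup_nu l s : cup l (map nu s) = cup l s.
Proof.
elim: l s => [|i l IH] [|x [|y s]] //=; rewrite ?size_map //.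
by rewrite !chi_nu addbN addNb negbK -(IH (y :: s)).
Qed.

(** By Stokes the value is that of [cup0 i l] on the sphere one dimension lower. The antipode
    negates [chi i] and fixes [cup l], so the two hemispheres together give [cup l] on one of
    them. *)
Lemma hemisphere_cup l : hemisphere (size l) (cup l).
Proof.
elim: l => [//|i l IH]; rewrite -[size _]/(size l).+1.
have -> : cup (i :: l) = coboundary (cup0 i l).
  by apply/funext => s; rewrite coboundary_cup0//; exact: coboundary_cup.
rewrite hemisphere_coboundary -hemisphereD.
suff -> : (fun s => cup0 i l s (+) (cup0 i l \o map nu) s) = cup l by [].
apply/funext => -[|x s] /=; first by case: (l).
by rewrite -[nu x :: _]/(map nu (x :: s)) cup_nu chi_nu; case: (chi i x); case: cup.
Qed.

Lemma cup_separates l s i : i \in l -> cup l s ->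
  exists x y, [/\ x \in s, y \in s, chi i x & ~~ chi i y].
Proof.
elim: l s => // j l IH [|x [|y s]] //; rewrite in_cons => ijl /andP[chij cupl].
case/predU1P: ijl => [->|/IH/(_ cupl)[u [v [us vs ? ?]]]]; last first.
  by exists u, v; split=> //; rewrite in_cons ?us ?vs orbT.
case: (boolP (chi j x)) chij => chijx chijy.
  by exists x, y; rewrite !in_cons !eqxx orbT.
by exists y, x; rewrite !in_cons !eqxx orbT; split.
Qed.

Lemma antipodal_cochains (Q : nat -> seq T -> Prop) l :
    Q 0 [:: x0] -> (forall j s, Q j s -> Q j (map nu s)) ->
    (forall j t s s', (t < N)%N -> Q j s ->
      (forall z, z \in s' ->
        exists2 x, x \in s & z = f j t x \/ z = f j t.+1 x) -> Q j.+1 s') ->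
  exists2 s, Q (size l) s & forall i, i \in l ->
    exists x y, [/\ x \in s, y \in s, chi i x & ~~ chi i y].
Proof.
move=> Q0 Qnu QS.
have [s Qs cups] := hemisphere_support Q0 Qnu QS (hemisphere_cup l).
by exists s => // i il; exact: cup_separates il cups.
Qed.

End hemispheres.

(** * The Lusternik-Schnirelmann theorem *)

Section octahedral_sphere.
Variables (R : realType) (n : nat).
Implicit Types x y : 'rV[R]_n.

(** The octahedral sphere is chosen because coning towards a new coordinate vector stays on it
    without normalization. *)
Definition norm1 x : R := \sum_(i < n) `|x 0 i|.

Lemma le_norm1 x : `|x| <= norm1 x.
Proof.
have [->|] := eqVneq x 0; first by rewrite normr0; apply: sumr_ge0.
rewrite -normr_eq0 => /mx_norm_neq0[[i j]].
rewrite -[mx_norm x]/`|x| => ->; rewrite ord1 /norm1 (bigD1 j)//= lerDl.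
exact: sumr_ge0.
Qed.

Lemma norm1N x : norm1 (- x) = norm1 x.
Proof. by apply: eq_bigr => i _; rewrite mxE normrN. Qed.

Lemma norm1_cone x (j : 'I_n) (t : R) : 0 <= t <= 1 -> x 0 j = 0 ->
  norm1 ((1 - t) *: x + t *: delta_mx 0 j) = (1 - t) * norm1 x + t.
Proof.
move=> /andP[t0 t1] xj0; rewrite /norm1 (bigD1 j)//= [in RHS](bigD1 j)//= xj0.
rewrite !mxE xj0 !eqxx mulr0 add0r mulr1 normr0 add0r (ger0_norm t0) addrC.
congr (_ + _); rewrite mulr_sumr; apply: eq_bigr => i /negbTE ij.
by rewrite !mxE ij andbF mulr0 addr0 normrM ger0_norm// subr_ge0.
Qed.

Lemma norm1_delta (j : 'I_n) : norm1 (delta_mx 0 j) = 1.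
Proof.
rewrite /norm1 (bigD1 j)//= big1 => [|i /negbTE ij]; last by rewrite mxE ij normr0.
by rewrite mxE !eqxx normr1 addr0.
Qed.

Lemma norm1_continuous : continuous norm1.
Proof.
apply: continuous_big => [|i _ x]; first exact: add_continuous.
by apply: continuous_comp; [exact: coord_continuous|exact: norm_continuous].
Qed.

Lemma compact_norm1_sphere : compact [set x | norm1 x = 1].
Proof.
apply: bounded_closed_compact.
  exists 1; split=> [|M M1 x /= x1]; first exact: num_real.
  by rewrite (le_trans (le_norm1 x))// x1 ltW.
have -> : [set x | norm1 x = 1] = norm1 @^-1` [set 1] by [].
apply: closed_comp => [x _|]; first exact: norm1_continuous.
exact: closed_eq.
Qed.

End octahedral_sphere.

(** Half of a good radius at [x] still works at all points near [x] or [- x]; compactness then makes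
    the radius uniform. *)
Lemma antipodal_lebesgue (R : realType) (n : nat) (I : finType)
    (K : set 'rV[R]_n) (A : I -> set 'rV[R]_n) :
  compact K -> (forall i, open (A i)) ->
  (forall i x, K x -> A i x \/ A i (- x)) ->
  exists2 e : R, 0 < e & forall i x, K x ->
    ball x e `<=` A i \/ ball (- x) e `<=` A i.
Proof.
move=> /compact_near_coveringP Kcover openA coverA.
have near_e i : \forall e \near 0^'+, K `<=` fun x : 'rV[R]_n =>
    ball x e `<=` A i \/ ball (- x) e `<=` A i.
  apply: Kcover => x Kx.
  have shrink y : A i y -> \forall y' \near y & e \near 0^'+, ball y' e `<=` A i.
    move=> Ay; have /nbhs_ballP[r /= r0 yrA] := open_nbhs_nbhs (conj (openA i) Ay).
    exists (ball y (r / 2), [set e | e < r / 2]) => /=.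
      split; first by apply: nbhsx_ballx; rewrite divr_gt0.
      by apply: nbhs_right_lt; rewrite divr_gt0.
    move=> [y' e] /= [yy' er] z y'z; apply: yrA.
    rewrite (splitr r); apply: ball_triangle yy' _.
    exact: le_ball (ltW er) _ y'z.
  have [/shrink|/shrink] := coverA i x Kx.
    by apply: filterS => -[y e] /= ?; left.
  case=> -[U W] /= [Ux W0] UW.
  exists (-%R @^-1` U, W) => /=; last by move=> [y e] /= ?; right; exact: (UW (- y, e)).
  by split=> //; exact: (@oppr_continuous R 'rV[R]_n x _ Ux).
have {}near_e : \forall e \near 0^'+, forall i, K `<=` fun x : 'rV[R]_n =>
    ball x e `<=` A i \/ ball (- x) e `<=` A i.
  exact: filter_forall.
have [e [e0 eP]] := filter_ex (filterI (nbhs_right_gt (0 : R)) near_e).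
by exists e.
Qed.

Section lusternik_schnirelmann.
Variables (R : realType) (d : nat).
Notation T := (bool * 'rV[R]_d.+1)%type.

(* The bit attached to a point lets [chi] break ties antipodally without having
   to choose a fundamental domain of the sphere. *)
Lemma antipodal_mesh (e : R) (chi : 'I_d -> T -> bool) : 0 < e ->
  (forall i b x, chi i (~~ b, - x) = ~~ chi i (b, x)) ->
  exists s : seq T,
    (forall a, a \in s -> norm1 a.2 = 1) /\
    (forall a b, a \in s -> b \in s -> `|a.2 - b.2| < e) /\
    (forall i, exists a b, [/\ a \in s, b \in s, chi i a & ~~ chi i b]).
Proof.
move=> e0 chiN.
(* Each cone adds at most [2 / N] to the mesh and [d] cones are taken. *)
pose N := (Num.bound (2 * d%:R / e)).+1.
have N0 : 0 < N%:R :> R by rewrite ltr0n.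
have Ne : 2 * d%:R / N%:R < e.
  rewrite ltr_pdivrMr// [e * _]mulrC -ltr_pdivrMr//.
  have q0 : 0 <= 2 * d%:R / e by rewrite divr_ge0// ?mulr_ge0// ltW.
  by rewrite (lt_trans (archi_boundP q0))// ltr_nat.
pose nu (a : T) : T := (~~ a.1, - a.2).
pose w t : R := t%:R / N%:R.
pose apex k : 'rV[R]_d.+1 := delta_mx 0 (inord k.+1).
(* Setting the bit at [t = N] makes the last map constant in both components, as coning requires. *)
pose f k t (a : T) : T :=
  ((t == N) || a.1, (1 - w t) *: a.2 + w t *: apex k).
(* The [k]-th chain lives in the first [k + 1] coordinates. Beyond [k = d] the index [inord] in
   [apex] is a default value, hence the guards. *)
pose Q k (s : seq T) := ((k <= d)%N -> forall a, a \in s -> norm1 a.2 = 1 /\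
    forall i : 'I_d.+1, (k < i)%N -> a.2 0 i = 0) /\
  ((k <= d)%N -> forall a b, a \in s -> b \in s -> `|a.2 - b.2| <= 2 * k%:R / N%:R).
have w01 t : (t <= N)%N -> 0 <= w t <= 1.
  by move=> tN; rewrite divr_ge0//= ler_pdivrMr// mul1r ler_nat.
have nuK : involutive nu by case=> b x; rewrite /nu /= negbK opprK.
have f0 k : f k 0 =1 id.
  by case=> b x; rewrite /f /w mul0r subr0 scale1r scale0r addr0.
have fN k a : f k N a = (true, apex k).
  by rewrite /f eqxx /w divff ?gt_eqF// subrr scale0r add0r scale1r.
have Q0 : Q 0 [:: (true, delta_mx 0 ord0)].
  split=> _ a; last first.
    by move=> b; rewrite !inE => /eqP -> /eqP ->; rewrite subrr normr0 mulr0 mul0r.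
  rewrite inE => /eqP -> /=; split=> [|i i0]; first exact: norm1_delta.
  by rewrite mxE eqxx -val_eqE /= gtn_eqF.
have Qnu k s : Q k s -> Q k (map nu s).
  move=> [supp mesh]; split=> [kd a|kd a b].
    move=> /mapP[c cs ->] /=; have [c1 c0] := supp kd _ cs.
    by rewrite norm1N; split=> // i ki; rewrite mxE c0 ?oppr0.
  move=> /mapP[c cs ->] /mapP[c' c's ->] /=.
  by rewrite -opprD normrN mesh.
have QS k t s s' : (t < N)%N -> Q k s ->
    (forall z, z \in s' -> exists2 x, x \in s & z = f k t x \/ z = f k t.+1 x) ->
    Q k.+1 s'.
  move=> tN [supp mesh] s's; split=> kd.
    move=> z /s's[x xs zE].
    have [tau [tau01 ->]] : exists tau, 0 <= tau <= 1 /\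
        z.2 = (1 - tau) *: x.2 + tau *: apex k.
      by case: zE => ->; [exists (w t)|exists (w t.+1)]; rewrite w01 // ltnW.
    have [x1 x0] := supp (ltnW kd) x xs.
    have kE : (inord k.+1 : 'I_d.+1) = k.+1 :> nat by rewrite inordK.
    rewrite norm1_cone ?x1 ?mulr1 ?subrK//; last by rewrite x0 ?kE.
    split=> // i ki; rewrite !mxE x0 ?(ltnW ki)// mulr0 add0r.
    by rewrite eqxx -val_eqE /= kE gtn_eqF ?mulr0.
  have step z : z \in s' -> exists x tau, [/\ x \in s, 0 <= tau <= 1,
      w t <= tau <= w t + N%:R^-1 & z.2 = (1 - tau) *: x.2 + tau *: apex k].
    have wS : w t.+1 = w t + N%:R^-1 by rewrite /w -natr1 mulrDl mul1r.
    move=> /s's[x xs [->|->]]; exists x.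
      by exists (w t); rewrite w01 ?(ltnW tN)// lexx lerDl invr_ge0 ltW.
    by exists (w t.+1); split=> //; rewrite ?w01// wS lexx lerDl invr_ge0 ltW.
  move=> z z' /step[x [u [xs /andP[u0 u1] /andP[tu ut] ->]]].
  move=> /step[x' [u' [x's u'01 /andP[tu' u't] ->]]].
  (* The first term is a shrunken base distance; the second moves along a cone line of length at
     most 2 by at most one layer. *)
  have -> : (1 - u) *: x.2 + u *: apex k - ((1 - u') *: x'.2 + u' *: apex k) =
      (1 - u) *: (x.2 - x'.2) + (u' - u) *: (x'.2 - apex k).
    by apply/rowP => i; rewrite !mxE; ring.
  have x'1 := (supp (ltnW kd) x' x's).1.
  have x'p : `|x'.2 - apex k| <= 2.
    rewrite (le_trans (ler_normB _ _))// (_ : 2 = 1 + 1 :> R) // lerD//.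
      by rewrite -x'1 le_norm1.
    by apply: le_trans (le_norm1 _) _; rewrite norm1_delta.
  rewrite (le_trans (ler_normD _ _))// !normrZ -[k.+1%:R]natr1 mulrDr mulr1 mulrDl lerD//.
    apply: le_trans (mesh (ltnW kd) _ _ xs x's).
    by rewrite ler_piMl// ger0_norm; lra.
  rewrite mulrC ler_pM//; rewrite ler_norml; lra.
have chi_nu i a : chi i (nu a) = ~~ chi i a by case: a => b x; exact: chiN.
have [s] := antipodal_cochains nuK f0 fN chi_nu (enum 'I_d) Q0 Qnu QS.
rewrite size_enum_ord => -[supp mesh] sep; exists s; split; [|split].
- by move=> a /(supp (leqnn d))[].
- move=> a b sa sb; apply: le_lt_trans (mesh _ _ _ sa sb) Ne.
  exact: leqnn.
- by move=> i; apply: sep; rewrite mem_enum.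
Qed.

(** The set of index [ord0] is held back: the other [d] sets are made to contain both [c] and [- c],
    and it then selects the sign. *)
Theorem lusternik_schnirelmann (A : 'I_d.+1 -> set 'rV[R]_d.+1) :
  (forall i, open (A i)) -> (forall i x, x != 0 -> A i x \/ A i (- x)) ->
  exists2 x, x != 0 & forall i, A i x.
Proof.
move=> openA coverA.
have neq0 (x : 'rV[R]_d.+1) : norm1 x = 1 -> x != 0.
  apply: contra_eq_neq => ->.
  by rewrite /norm1 big1 1?eq_sym ?oner_neq0// => i _; rewrite mxE normr0.
have [e e0 eA] := antipodal_lebesgue (@compact_norm1_sphere R d.+1) openA
  (fun i x x1 => coverA i x (neq0 x x1)).
pose inA i x := `[< ball x e `<=` A i >].
(* The bit decides when the balls around [x] and [- x] lie both inside or both not inside; on the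
   sphere [eA] excludes the latter. *)
pose chi (i : 'I_d) (a : T) :=
  if inA (lift ord0 i) a.2 == inA (lift ord0 i) (- a.2) then a.1
  else inA (lift ord0 i) a.2.
have chiN i b x : chi i (~~ b, - x) = ~~ chi i (b, x).
  rewrite /chi /= opprK eq_sym; case: eqVneq => // ne.
  by case: (inA _ x) ne; case: (inA _ (- x)).
have [s [s1 [mesh sep]]] := antipodal_mesh e0 chiN.
have [c c1 cmesh] : exists2 c : 'rV[R]_d.+1, norm1 c = 1 &
    forall a, a \in s -> `|a.2 - c| < e.
  (* An empty [s] occurs only for [d = 0], where any point serves. *)
  case: s s1 mesh {sep} => [_ _|c s s1 mesh].
    by exists (delta_mx 0 ord0); [exact: norm1_delta|].
  by exists c.2 => [|a sa]; [apply: s1|apply: mesh]; rewrite ?mem_head.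
have c_in i : A (lift ord0 i) c /\ A (lift ord0 i) (- c).
  have [a [b [sa sb]]] := sep i; rewrite /chi.
  have near_a := eA (lift ord0 i) a.2 (s1 a sa).
  have near_b := eA (lift ord0 i) b.2 (s1 b sb).
  have ca : inA (lift ord0 i) a.2 -> A (lift ord0 i) c.
    by move=> /asboolP; apply; rewrite -ball_normE /=; exact: cmesh.
  have cb : inA (lift ord0 i) (- b.2) -> A (lift ord0 i) (- c).
    by move=> /asboolP; apply; rewrite -ball_normE /= -opprD normrN; exact: cmesh.
  move=> chia chib; split; [apply: ca; move: chia|apply: cb; move: chib].
  - case: eqVneq => [same _|//].
    by case: near_a => /asboolP // near_Na; rewrite same.
  - case: eqVneq => [same _|diff /negbTE far]; last first.
      by move: diff; rewrite far; case: (inA _ _).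
    by case: near_b => /asboolP // near_b; rewrite -same.
have c0 : c != 0 by exact/neq0.
have [A0|A0] := coverA ord0 c c0.
  by exists c => // i; case: (unliftP ord0 i) => [j ->|-> //]; have [] := c_in j.
exists (- c); first by rewrite oppr_eq0.
by move=> i; case: (unliftP ord0 i) => [j ->|-> //]; have [] := c_in j.
Qed.
End lusternik_schnirelmann.

(** * Half-spheres *)

Section euclidean.
Variables (R : realType) (n : nat).
Implicit Types u x y : 'rV[R]_n.

Lemma innerC x y : inner x y = inner y x.
Proof. by apply: eq_bigr => i _; rewrite mulrC. Qed.

Lemma innerDr u x y : inner u (x + y) = inner u x + inner u y.
Proof. by rewrite -big_split; apply: eq_bigr => i _; rewrite mxE mulrDr. Qed.

Lemma innerZr (c : R) u x : inner u (c *: x) = c * inner u x.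
Proof. by rewrite mulr_sumr; apply: eq_bigr => i _; rewrite mxE mulrCA. Qed.

Lemma innerZl (c : R) u x : inner (c *: u) x = c * inner u x.
Proof. by rewrite innerC innerZr innerC. Qed.

Lemma inner_sumr (I : finType) u (F : I -> 'rV[R]_n) :
  inner u (\sum_i F i) = \sum_i inner u (F i).
Proof.
rewrite /inner exchange_big /=; apply: eq_bigr => i _.
by rewrite summxE mulr_sumr.
Qed.

Lemma inner_ge0 x : 0 <= inner x x.
Proof. by apply: sumr_ge0 => i _; rewrite -expr2 sqr_ge0. Qed.

Lemma inner_eq0 x : (inner x x == 0) = (x == 0).
Proof.
apply/eqP/eqP => [/psumr_eq0P x0|->]; last first.
  by rewrite /inner big1// => i _; rewrite mxE mul0r.
apply/rowP => i; rewrite mxE; apply/eqP; rewrite -sqrf_eq0 expr2.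
by rewrite x0// => j _; rewrite -expr2 sqr_ge0.
Qed.

Lemma enorm_ge0 x : 0 <= enorm x.
Proof. exact: sqrtr_ge0. Qed.

Lemma enorm_eq0 x : (enorm x == 0) = (x == 0).
Proof. by rewrite sqrtr_eq0 -inner_eq0 eq_le inner_ge0 andbT. Qed.

Lemma enormZ (c : R) x : 0 <= c -> enorm (c *: x) = c * enorm x.
Proof.
move=> c0; rewrite /enorm innerZl innerZr mulrA -expr2.
by rewrite sqrtrM ?sqr_ge0// sqrtr_sqr ger0_norm.
Qed.

Lemma enorm_normalize x : x != 0 -> enorm ((enorm x)^-1 *: x) = 1.
Proof.
by move=> x0; rewrite enormZ ?invr_ge0 ?enorm_ge0// mulVf// enorm_eq0.
Qed.

Lemma enorm_continuous : continuous (@enorm R n).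
Proof.
move=> x; apply: continuous_comp; last exact: sqrt_continuous.
apply: continuous_big => [|i _ {}x]; first exact: add_continuous.
by apply: continuousM; exact: coord_continuous.
Qed.

Lemma mulmxr_continuous m (B : 'M[R]_(m, n)) :
  continuous (fun a : 'rV[R]_m => a *m B).
Proof.
under [X in continuous X]eq_fun do rewrite mulmx_sum_row.
apply: continuous_big => [|j _ a]; first exact: add_continuous.
by apply: continuousZr_tmp; exact: coord_continuous.
Qed.

(* [x] and [t] cannot be kept fixed when [a] moves: the point has to be brought
   back to the unit sphere. *)
Lemma open_cone_preimage m (B : 'M[R]_(m, n)) (M : {vspace 'rV[R]_n}) V :
  open_in_usphere V ->
  open [set a : 'rV[R]_m | exists x t, [/\ x \in M, 0 <= t & V (x + t *: (a *m B))]].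
Proof.
move=> [U openU ->]; rewrite openE => a [x [t [xM t0 [Uy y1]]]].
pose g b := x + t *: (b *m B).
have gcont : {for a, continuous g}.
  apply: continuousD; first exact: cst_continuous.
  by apply: continuousZl_tmp; exact: mulmxr_continuous.
have ngcont : {for a, continuous (fun b => enorm (g b))}.
  by apply: continuous_comp => //; exact: enorm_continuous.
have hcont : {for a, continuous (fun b => (enorm (g b))^-1 *: g b)}.
  apply: continuousZ => //; apply: continuousV => //.
  by rewrite y1 oner_neq0.
have nearU : \forall b \near a, U ((enorm (g b))^-1 *: g b).
  by apply: (hcont U); rewrite /= y1 invr1 scale1r; exact: open_nbhs_nbhs.
have near0 : \forall b \near a, 0 < enorm (g b).
  by apply: (ngcont [set r | 0 < r]); rewrite /= y1; exact/open_nbhs_nbhs/(conj (@open_gt R 0))/ltr01.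
apply: filterS2 nearU near0 => b Ub gb0.
exists ((enorm (g b))^-1 *: x), ((enorm (g b))^-1 * t).
rewrite -scalerA -scalerDr -/(g b); split.
- exact: memvZ.
- by rewrite mulr_ge0// invr_ge0 enorm_ge0.
- by split=> //; rewrite /usphere /= enorm_normalize// -enorm_eq0 gt_eqF.
Qed.

End euclidean.

(** * Subspaces of prescribed dimension *)

Section dimension.
Variables (K : fieldType) (vT : vectType K).
Implicit Types U W : {vspace vT}.

Lemma dim_addv_line U v : v \notin U -> \dim (U + <[v]>)%VS = (\dim U).+1.
Proof.
move=> vU; have v0 : v != 0 by apply: contraNneq vU => ->; exact: mem0v.
rewrite dimv_disjoint_sum ?dim_vline ?v0 ?addn1//.
apply/eqP; rewrite -subv0; apply/subvP => w /memv_capP[wU /vlineP[c wE]].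
rewrite memv0 wE scaler_eq0 (negbTE v0) orbF; apply: contraNT vU => c0.
by rewrite -(scale1r v) -(mulVf c0) -scalerA -wE memvZ.
Qed.

Lemma vspace_extension U m : (\dim U <= m <= dim vT)%N ->
  exists2 W, (U <= W)%VS & \dim W = m.
Proof.
elim: m => [|m IH] /andP[Um mT].
  by exists U => //; apply/eqP; rewrite -leqn0.
move: Um; rewrite leq_eqVlt => /predU1P[Um|]; first by exists U.
rewrite ltnS => Um; have [|W UW Wm] := IH; first by rewrite Um ltnW.
have [v vW] : exists v, v \notin W.
  apply: contrapT => Wfull.
  suff : (dim vT <= m)%N by rewrite leqNgt mT.
  rewrite -Wm -dimvf dimvS//; apply/subvP => v _.
  by apply: contrapT => /negP vW; apply: Wfull; exists v.
exists (W + <[v]>)%VS; last by rewrite dim_addv_line ?Wm.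
exact: subv_trans UW (addvSl _ _).
Qed.

End dimension.

(** By rank-nullity the left kernel has room for [m] independent rows. With a basis of [M] as
    columns of [C], the map [a *m B] parametrizes directions orthogonal to [M]. *)
Lemma row_free_kernel (K : fieldType) k m (C : 'M[K]_(k + m, k)) :
  exists2 B : 'M[K]_(m, k + m), row_free B & B *m C = 0.
Proof.
have rank_ker : (m <= \rank (kermx C))%N.
  by rewrite mxrank_ker leq_subRL ?rank_leq_row// leq_add2r ?rank_leq_col.
exists (pid_mx m *m row_base (kermx C)).
  by rewrite /row_free mxrankMfree ?row_base_free// rank_pid_mx.
by rewrite -mulmxA; apply/eqP; rewrite (_ : row_base _ *m C = 0) ?mulmx0//; apply/sub_kermxP; rewrite eq_row_base.
Qed.

(** Here [k] is one less than the dimension in the theorem; [lshift] indexes the sets met inside [M]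
    and [rshift] the [d + 1] sets left to Lusternik-Schnirelmann. *)
Lemma half_sphere_transversal (R : realType) (k d : nat)
    (V : 'I_(k + d.+1) -> set 'rV[R]_(k + d.+1)) :
  (forall i, open_in_usphere (V i)) ->
  (forall i C, subsphere k.+1 C -> V i `&` C !=set0) ->
  exists2 H, half_sphere k.+1 H & forall i, V i `&` H !=set0.
Proof.
move=> openV meetV.
have dimT : dim 'rV[R]_(k + d.+1) = (k + d.+1)%N by rewrite /dim /= mul1n.
have V1 i x : V i x -> enorm x = 1 by case: (openV i) => U _ -> [].
have nonemptyV (i : 'I_k) : exists y, V (lshift d.+1 i) y.
  have [|L _ dimL] := @vspace_extension _ 'rV[R]_(k + d.+1) 0%VS k.+1.
    by rewrite dimv0 dimT addnS ltnS leq_addr.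
  have [y [Vy _]] := meetV (lshift _ i) _ (ex_intro2 _ _ L dimL erefl).
  by exists y.
have [x Vx] := choice nonemptyV.
(* The chosen points may be dependent, so their span is enlarged to dimension exactly [k]. *)
have [|M xM dimM] := @vspace_extension _ _ <<[tuple x i | i < k]>>%VS k.
  by rewrite dimT leq_addr andbT (leq_trans (dim_span _)) ?size_tuple.
have {}xM i : x i \in M.
  by apply: (subvP xM); apply: memv_span; apply/mapP; exists i; rewrite ?mem_enum.
pose C : 'M[R]_(k + d.+1, k) := \matrix_(i, j) (vbasis M)`_j 0 i.
have [B freeB BC] := row_free_kernel C.
have orthM a y : y \in M -> inner (a *m B) y = 0.
  move=> /coord_vbasis ->; rewrite inner_sumr big1// => j _.
  rewrite innerZr; set b := (vbasis M)`_j.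
  have : a *m B *m C = 0 by rewrite -mulmxA BC mulmx0.
  move=> /rowP/(_ (cast_ord dimM j)); rewrite !mxE => aBb.
  rewrite [inner _ _](_ : _ = 0) ?mulr0// -[RHS]aBb.
  by apply: eq_bigr => i _; congr (_ * _); rewrite mxE.
have v0 a : a != 0 -> a *m B != 0.
  by apply: contra_neq => aB; apply: (row_free_inj freeB); rewrite mul0mx.
have vM a : a != 0 -> a *m B \notin M.
  move=> /v0; apply: contra => /(orthM a)/eqP.
  by rewrite inner_eq0.
pose L a := (M + <[a *m B]>)%VS.
have dimL a : a != 0 -> \dim (L a) = k.+1.
  by move=> /vM/dim_addv_line; rewrite dimM.
have [i|i a a0|a a0 Aa] := @lusternik_schnirelmann R d (fun i => [set a | exists y t,
    [/\ y \in M, 0 <= t & V (rshift k i) (y + t *: (a *m B))]]).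
- exact: open_cone_preimage.
(* A point of [V_i] in [L a] has the form [m + t *: (a *m B)]; the sign of [t] tells whether [a] or
   [- a] is covered. *)
- have [y [Vy [/memv_addP[m mM [_ /vlineP[t ->] yE]] _]]] :=
    meetV (rshift k i) _ (ex_intro2 _ _ (L a) (dimL a a0) erefl).
  rewrite {}yE in Vy; have [t0|t0] := leP 0 t; [left|right].
    by exists m, t.
  by exists m, (- t); rewrite oppr_ge0 ltW// mulNmx scalerN scaleNr opprK.
pose v := a *m B; pose u := (enorm v)^-1 *: v.
have vL : v \in L a by apply: (subvP (addvSr _ _)); exact: memv_line.
have ML y : y \in M -> y \in L a by apply/subvP; exact: addvSl.
exists ([set y | y \in L a] `&` @usphere R _ `&` [set y | 0 <= inner u y]).
  exists (L a), u; split=> //; first exact: dimL.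
    exact: memvZ.
  by rewrite enorm_normalize// v0.
move=> i; case: (split_ordP i) => j ->.
  (* Points of [M] are orthogonal to [u], so they lie on the rim of the half-sphere. *)
  exists (x j); split; first exact: Vx.
  split; last by rewrite /= innerZl orthM// mulr0.
  by split; [exact: ML|exact: V1 (Vx j)].
have [y [t [yM t0 Vy]]] := Aa j; exists (y + t *: v); split=> //.
split; first by split; [rewrite /= memvD ?memvZ// ML|exact: V1 Vy].
rewrite /= innerZl innerDr orthM// add0r innerZr.
by rewrite mulr_ge0 ?mulr_ge0 ?invr_ge0 ?enorm_ge0 ?inner_ge0.
Qed.

Theorem theorem7p7 (R : realType) (n k : nat) (hk1 : (1 <= k)%N)
    (hkn : (k <= n)%N) (V : 'I_n -> set 'rV[R]_n)
    (hVopen : forall i : 'I_n, open_in_usphere (V i))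
    (hV : forall (i : 'I_n) (C : set 'rV[R]_n),
        subsphere k C -> V i `&` C !=set0) :
  exists2 H : set 'rV[R]_n,
    half_sphere k H & forall i : 'I_n, V i `&` H !=set0.
Proof.
case: k hk1 hkn hV => // k _ kn.
have nE : n = (k + (n - k.+1).+1)%N by rewrite addnS -addSn subnKC.
move: (n - k.+1)%N nE => d nE; subst n; exact: half_sphere_transversal.
Qed.
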